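(* Let $(G,\cdot)$ be a (nonempty) groupoid. The following conditions are equivalent: (1) $(G,\cdot)$ is an AG-group. (2) $(G,\cdot)$ is an AG$^{**}$-quasigroup. (3) $(G,\cdot)$ is a paramedial quasigroup with a left unit. (4) There exist an abelian group $(G,+)$ on the same underlying set $G$ and an automorphism $\varphi$ of $(G,+)$ satisfying $\varphi^2=\mathrm{id}$ such that $a\cdot b=\varphi(a)+b$ for every $a,b\in G$.
   Context: A groupoid $(G,\cdot)$ is a nonempty set $G$ with a single binary operation $\cdot$ (no axioms assumed). An element $e\in G$ is a left unit if $e\cdot a=a$ for every $a\in G$. A groupoid is an AG-groupoid (Abel-Grassmann groupoid) if $(a\cdot b)\cdot c=(c\cdot b)\cdot a$ for all $a,b,c\in G$. An AG$^{**}$-groupoid is an AG-groupoid that additionally satisfies $a\cdot(b\cdot c)=b\cdot(a\cdot c)$ for all $a,b,c\in G$. An AG-group (Abel-Grassmann group) is a groupoid $(G,\cdot)$ such that: $(a\cdot b)\cdot c=(c\cdot b)\cdot a$ for all $a,b,c\in G$; there exists a left unit $e$; and for every $a\in G$ there exists a unique $a^{-1}\in G$ such that $a\cdot a^{-1}=a^{-1}\cdot a=e$. A quasigroup is a groupoid in which for all $a,b$ there is a unique $x$ with $a\cdot x=b$ and a unique $y$ with $y\cdot a=b$. An AG$^{**}$-quasigroup is a quasigroup that is an AG$^{**}$-groupoid. A groupoid is paramedial if $(a\cdot b)\cdot(c\cdot d)=(d\cdot b)\cdot(c\cdot a)$ for all $a,b,c,d\in G$. *)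

(* Defs.v *)
From HB Require Import structures.
From mathcomp Require Import all_boot all_algebra.

Set Implicit Arguments.
Unset Strict Implicit.
Unset Printing Implicit Defensive.

Local Open Scope group_scope.

(* A groupoid in the sense of universal algebra is a [magmaType]: a carrier   *)
(* type with a binary operation [x * y] subject to no law. Nonemptiness is    *)
(* not part of [magmaType] and has to be assumed separately.                  *)

Definition AG_groupoid (G : magmaType) : Prop :=
  forall a b c : G, (a * b) * c = (c * b) * a.

Definition AGss_groupoid (G : magmaType) : Prop :=
  AG_groupoid G /\ forall a b c : G, a * (b * c) = b * (a * c).

Definition left_unit (G : magmaType) (e : G) : Prop :=
  forall a : G, e * a = a.

Definition AG_group (G : magmaType) : Prop :=
  AG_groupoid G /\
  exists e : G, left_unit e /\
    forall a : G, exists! a' : G, a * a' = e /\ a' * a = e.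

Definition quasigroup (G : magmaType) : Prop :=
  forall a b : G, (exists! x : G, a * x = b) /\ (exists! y : G, y * a = b).

Definition AGss_quasigroup (G : magmaType) : Prop :=
  quasigroup G /\ AGss_groupoid G.

Definition paramedial (G : magmaType) : Prop :=
  forall a b c d : G, (a * b) * (c * d) = (d * b) * (c * a).

(* [GRing.Zmodule G] is the type of [zmodType] structures on the carrier of   *)
(* [G], so that [A] below is an abelian group on the same underlying type.    *)
(* It includes a [choiceType] structure, which is no restriction on [G]       *)
(* since classically every type has one.                                      *)
Definition involutive_automorphism_form (G : magmaType) : Prop :=
  exists (add_str : GRing.Zmodule G),
    let A : zmodType := GRing.Zmodule.Pack add_str in
    exists phi : {additive A -> A},
      [/\ bijective phi,
          forall a : A, phi (phi a) = a
        & forall a b : G, a * b = (phi a + b)%R].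

(* Main.v *)
Require Import Defs.
From HB Require Import structures.
From mathcomp Require Import all_boot all_algebra boolp.

Set Implicit Arguments.
Unset Strict Implicit.
Unset Printing Implicit Defensive.

(** In an AG-groupoid with a left unit [e], the map [phi a = a e] is an
    involution and [a b = phi a + b] for [a + b := (a e) b]. The AG law makes
    this [+] associative and commutative, division makes it a group, and [phi]
    is then additive. *)

Import GRing.Theory.

Local Open Scope group_scope.

Lemma AG_medial (G : magmaType) (a b c d : G) :
  AG_groupoid G -> (a * b) * (c * d) = (a * c) * (b * d).
Proof. by move=> AG; rewrite AG [c * d * b]AG AG. Qed.

(** Padding [a] to [e * a] lets the medial law swap [a] with [b]. *)
Lemma AG_left_unit_mulCA (G : magmaType) (e a b c : G) :
  AG_groupoid G -> left_unit e -> a * (b * c) = b * (a * c).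
Proof.
by move=> AG ue; rewrite -{1}(ue a) AG_medial // ue.
Qed.

Lemma AG_group_AGss_quasigroup (G : magmaType) :
  AG_group G -> AGss_quasigroup G.
Proof.
move=> [AG [e [ue inv]]].
split; last by split=> // a b c; apply: AG_left_unit_mulCA ue.
move=> a b; have [a' [[aa' a'a] _]] := inv a; split.
  (* Pulling [b * e] out of [a * x] leaves [(b * e) * (a * a') = (b * e) * e], and right
     multiplication by [e] is an involution. *)
  exists ((b * e) * a'); split.
    by rewrite (AG_left_unit_mulCA _ _ _ AG ue) aa' AG !ue.
  move=> x <-; rewrite -{1}(ue a) [e * a * x]AG.
  by rewrite [x * a * e * e]AG !ue AG a'a ue.
exists (b * a'); split; first by rewrite AG aa' ue.
by move=> y <-; rewrite AG a'a ue.
Qed.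

Lemma AGss_quasigroup_paramedial (G : magmaType) :
  inhabited G -> AGss_quasigroup G ->
  quasigroup G /\ paramedial G /\ (exists e : G, left_unit e).
Proof.
move=> [g] [quasi [AG mulCA]]; split=> //; split.
  by move=> a b c d; rewrite mulCA AG mulCA.
(* Here [e] is only chosen to fix [g]; every element has the form [c * g], and [mulCA] moves [e]
   past [c]. *)
have [_ [e [eg _]]] := quasi g g.
exists e => a; have [_ [c [<- _]]] := quasi g a.
by rewrite mulCA eg.
Qed.

(** Classical axioms supply the equality and choice structures on the bare type. Exposing the
    addition suffices, as it determines zero and opposites. *)
Lemma zmodule_of_abelian_group (T : Type) (zero : T) (opp : T -> T)
    (add : T -> T -> T) :
    associative add -> commutative add -> left_id zero add ->
    left_inverse zero opp add ->
  exists s : GRing.Zmodule T,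
    forall a b : T, @GRing.add (GRing.Zmodule.Pack s) a b = add a b.
Proof.
move=> addA addC add0 addN.
pose C : choiceType := HB.pack T (gen_eqMixin T) (gen_choiceMixin T).
pose V : zmodType := HB.pack T (Choice.on C)
  (GRing.isZmodule.Build C addA addC add0 addN).
by exists (GRing.Zmodule.class V).
Qed.

Section ParamedialLeftUnit.

Variables (G : magmaType) (e : G).
Hypotheses (pm : paramedial G) (ue : left_unit e).

(** Padding [c] to [e * c] lets the paramedial law swap the outer factors [a] and [c]. *)
Lemma paramedial_left_unit_AG : AG_groupoid G.
Proof. by move=> a b c; rewrite -{1}(ue c) pm ue. Qed.

Let AG := paramedial_left_unit_AG.

Lemma mulre_involutive (a : G) : (a * e) * e = a.
Proof. by rewrite AG !ue. Qed.

Lemma mulreC (a b : G) : (a * e) * b = (b * e) * a.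
Proof. exact: AG. Qed.

Lemma mulre_mul (a b : G) : (a * b) * e = b * a.
Proof. by rewrite AG ue. Qed.

(** Associativity of the new sum: the sides reduce to [(c * (b * e)) * a] and [(a * (b * e)) * c],
    which the AG law exchanges. *)
Lemma mulreA (a b c : G) :
  (a * e) * ((b * e) * c) = (((a * e) * b) * e) * c.
Proof.
by rewrite [LHS]mulreC !mulre_mul (AG_left_unit_mulCA b a e AG ue) AG.
Qed.

End ParamedialLeftUnit.

Lemma paramedial_involutive_automorphism_form (G : magmaType) :
  quasigroup G /\ paramedial G /\ (exists e : G, left_unit e) ->
  involutive_automorphism_form G.
Proof.
move=> [quasi [pm [e ue]]].
have AG := paramedial_left_unit_AG pm ue.
have eK := mulre_involutive pm ue.
have /choice [inv invE] : forall a, exists y : G, y * a = e.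
  by move=> a; have [_ [y []]] := quasi a e; exists y.
have add0 a : (e * e) * a = a by rewrite !ue.
(* The opposite [inv a * e] carries an extra [e] to undo the one that the sum puts on its left
   argument. *)
have addN a : (inv a * e * e) * a = e by rewrite eK invE.
have [s addE] := zmodule_of_abelian_group (mulreA pm ue) (mulreC pm ue)
  add0 addN.
pose A : zmodType := GRing.Zmodule.Pack s.
pose phi (a : A) : A := (a : G) * e.
have phiB : {morph phi : a b / (a + b)%R}.
  (* The two sides become [b * (a * e)] and [a * (b * e)]. *)
  move=> a b; rewrite /phi !addE eK mulre_mul //.
  exact: AG_left_unit_mulCA ue.
have phi_add : nmod_morphism phi.
  (* The zero of [A] is known only through its addition, so [phi 0 = 0] comes from cancellation in
     [phi 0 + phi 0 = phi 0]. *)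
  by split=> //; apply: (@addrI A (phi 0%R)); rewrite -phiB !addr0.
pose phiA : {additive A -> A} := HB.pack phi
  (GRing.isNmodMorphism.Build A A phi phi_add).
exists s, phiA; split=> [|a|a b]; first by exists phi => a; apply: eK.
  exact: eK.
by rewrite addE; congr (_ * b); rewrite [RHS]eK.
Qed.

Lemma involutive_automorphism_form_AG_group (G : magmaType) :
  involutive_automorphism_form G -> AG_group G.
Proof.
move=> [s]; set A : zmodType := GRing.Zmodule.Pack s.
move=> [phi [_ phiK mulE]]; split.
  (* Since [phi] is an involution, [(a * b) * c] expands to [a + phi b + c], symmetric in [a] and
     [c]. *)
  move=> a b c; rewrite !mulE !raddfD !phiK.
  by rewrite addrAC [RHS]addrAC (addrC (a : A)).
exists (0%R : A); split=> [a|a]; first by rewrite mulE raddf0 add0r.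
exists (- phi a : A)%R; split.
  by rewrite !mulE raddfN phiK subrr addNr.
move=> x [ax _]; apply: (@addrI A (phi a)).
by rewrite subrr -mulE ax.
Qed.

Theorem theorem1p1 (G : magmaType) (G_nonempty : inhabited G) :
  [<-> AG_group G;
       AGss_quasigroup G;
       quasigroup G /\ paramedial G /\ (exists e : G, left_unit e);
       involutive_automorphism_form G].
Proof.
tfae.
- exact: AG_group_AGss_quasigroup.
- exact: AGss_quasigroup_paramedial.
- exact: paramedial_involutive_automorphism_form.
- exact: involutive_automorphism_form_AG_group.
Qed.
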